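(* Let $\Gamma\subset\mathbb{C}$ be a quasiline, and let $h\colon\Gamma\to\mathbb{R}$ be a quasisymmetric homeomorphism. If $h$ is equidistant weakly asymptotically symmetric (EWAS), then $h$ is asymptotically symmetric (AS). Consequently, for such $h$ the conditions EWAS, WAS (weakly asymptotically symmetric), and AS are equivalent.
   Context: Let $X,Y$ be metric spaces with distances written $|x_1-x_2|$; subsets of $\mathbb{C}$ carry the Euclidean metric. An embedding $h\colon X\to Y$ (homeomorphism onto its image) is quasisymmetric if there is a homeomorphism $\eta\colon[0,\infty)\to[0,\infty)$ such that for any three distinct points $a,b,x\in X$ and $t\ge 0$, $\frac{|a-x|}{|b-x|}\le t$ implies $\frac{|h(a)-h(x)|}{|h(b)-h(x)|}\le\eta(t)$. A quasiline is a set $\Gamma\subset\mathbb{C}$ that is the image $f(\mathbb{R})$ of a quasisymmetric embedding $f\colon\mathbb{R}\to\mathbb{C}$ (together with $\infty$ it is a Jordan curve in the Riemann sphere). $h$ is asymptotically symmetric (AS) if for every $\varepsilon>0$ and every $t>0$ there exists $\delta>0$ such that for all distinct $a,b,x\in X$ with $\operatorname{diam}\{a,b,x\}\le\delta$: $\frac{|a-x|}{|b-x|}\le t$ implies $\frac{|h(a)-h(x)|}{|h(b)-h(x)|}\le(1+\varepsilon)t$. $h$ is weakly asymptotically symmetric (WAS) if this is required only for $t=1$ (for every $\varepsilon>0$). For $r>0$ put $$H_h^{\mathrm{eq}}(r)=\sup\left\{\max\left(\tfrac{|h(a)-h(x)|}{|h(b)-h(x)|},\tfrac{|h(b)-h(x)|}{|h(a)-h(x)|}\right):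 a,b,x\in X,\ |a-x|=|b-x|,\ 0<\operatorname{diam}\{a,b,x\}\le r\right\}.$$ $h$ is equidistant weakly asymptotically symmetric (EWAS) if $H_h^{\mathrm{eq}}(r)\to1$ as $r\to0$. *)

(* Defs.v *)
From HB Require Import structures.
From mathcomp Require Import all_boot all_order all_algebra.
From mathcomp Require Import complex.
From mathcomp Require Import all_classical all_reals all_analysis.

Set Implicit Arguments.
Unset Strict Implicit.
Unset Printing Implicit Defensive.

Import Order.TTheory GRing.Theory Num.Theory.
Import numFieldNormedType.Exports.

Local Open Scope classical_set_scope.
Local Open Scope ring_scope.

(* The library makes [R^o] a metric space, but not [R] itself. *)
HB.instance Definition _ (R : realType) := Metric.copy R R^o.

(* [Rcomplex R] is [R[i]] normed over [R] (the norm of [R[i]] itself takes its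
   values in [R[i]]); its norm is the Euclidean one, sqrt (Re^2 + Im^2). *)
Section Rcomplex_metric.
Context {R : realType}.
Implicit Types x y z : Rcomplex R.

Let dist x y : R := `|y - x|.

Let distxx x : dist x x = 0.
Proof. by rewrite /dist subrr normr0. Qed.

Let dist_positivity x y : dist x y = 0 -> x = y.
Proof. by move/normr0_eq0/eqP; rewrite subr_eq0 => /eqP. Qed.

Let dist_sym x y : dist x y = dist y x.
Proof. exact: distrC. Qed.

Let dist_triangle y x z : dist x z <= dist x y + dist y z.
Proof. by rewrite /dist [leRHS]addrC -[z - x](subrKA y); exact: ler_normD. Qed.

HB.instance Definition _ := isMetric.Build R (Rcomplex R)
  distxx dist_positivity dist_sym dist_triangle.

HB.instance Definition _ := isPointed.Build (Rcomplex R) 0.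

HB.instance Definition _ := NormedZmoduleMetric.Build R (Rcomplex R)
  (fun x y => erefl).

End Rcomplex_metric.

(* Maps between subspaces are total functions used only on the subspace. *)

Definition homeomorphism_on (X Y : topologicalType) (A : set X) (B : set Y)
    (f : X -> Y) : Prop :=
  [/\ set_bij A B f, {within A, continuous f} &
      exists g : Y -> X,
        (forall x, A x -> g (f x) = x) /\ {within B, continuous g}].

Definition embedding_on (X Y : topologicalType) (A : set X) (f : X -> Y) :
    Prop :=
  homeomorphism_on A (f @` A) f.

Section maps_between_metric_spaces.
Context {R : realType} {X Y : metricType R}.
Implicit Types (A : set X) (h : X -> Y).

Definition diam (S : set X) : \bar R :=
  ereal_sup [set (mdist x y)%:E | x in S & y in S].

Definition quasisymmetric_on A h : Prop :=
  embedding_on A h /\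
  exists eta : R -> R,
    homeomorphism_on [set t : R | 0 <= t] [set t : R | 0 <= t] eta /\
    forall a b x t, A a -> A b -> A x -> a <> b -> a <> x -> b <> x -> 0 <= t ->
      mdist a x / mdist b x <= t ->
      mdist (h a) (h x) / mdist (h b) (h x) <= eta t.

Definition asymptotically_symmetric_at (t : R) A h : Prop :=
  forall eps : R, 0 < eps -> exists2 delta : R, 0 < delta &
    forall a b x, A a -> A b -> A x -> a <> b -> a <> x -> b <> x ->
      (diam [set a; b; x] <= delta%:E)%E ->
      mdist a x / mdist b x <= t ->
      mdist (h a) (h x) / mdist (h b) (h x) <= (1 + eps) * t.

Definition AS A h : Prop :=
  forall t : R, 0 < t -> asymptotically_symmetric_at t A h.

Definition WAS A h : Prop := asymptotically_symmetric_at 1 A h.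

(* Valued in the extended reals, since the supremum may be infinite. *)
Definition Heq A h (r : R) : \bar R :=
  ereal_sup [set q | exists a b x, [/\ A a, A b & A x] /\
    [/\ mdist a x = mdist b x, (0 < diam [set a; b; x] <= r%:E)%E &
        q = (Num.max (mdist (h a) (h x) / mdist (h b) (h x))
                     (mdist (h b) (h x) / mdist (h a) (h x)))%:E]].

Definition EWAS A h : Prop := Heq A h r @[r --> 0^'+] --> 1%E.

End maps_between_metric_spaces.

Definition quasiline (R : realType) (Gamma : set (Rcomplex R)) : Prop :=
  exists f : R -> Rcomplex R, quasisymmetric_on setT f /\ Gamma = range f.

(* Main.v *)
Require Import Defs.
From mathcomp Require Import all_boot all_order all_algebra.
From mathcomp Require Import ring lra.
From mathcomp Require Import complex.
From mathcomp Require Import all_classical all_reals all_analysis.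

(** The idea is to blow up. Parametrize [Gamma] by [g], the inverse of [h]. If [h] is
    not asymptotically symmetric, rescale [g] around worse and worse triples;
    the quasisymmetry of [h] makes the rescaled curves precompact, and EWAS
    makes every ultralimit [p : R -> C] satisfy |p(x + u) - p(x)| = |p(x) - p(x - u)|
    exactly.

    Such an injective curve, unbounded along arithmetic progressions, satisfies
    |p(s) - p(0)| = |s| |p(1) - p(0)|, which contradicts the choice of the
    triples. Indeed |p(x + m u) - p(x)| is periodic in [x] with period [m u].
    For each [u] the curve cannot always turn in the same direction at scale
    [u], since otherwise the polygon p(x + k u) would be bounded; hence some
    p(x) is the midpoint of p(x - u) and p(x + u). Comparing chords over 2u, 4u
    and 5u then shows that the polygon p(x + u + 2 k u) is either bounded or has
    edges of period two, so that |p(y + 4 k u) - p(y)| is linear in [k] for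
    y = x + u, which can be taken in [0, 3u]. Let [u] tend to 0.

    It matters that the target is a plane: helices in R^3 satisfy the same equation. *)

Set Implicit Arguments.
Unset Strict Implicit.
Unset Printing Implicit Defensive.

Import Order.TTheory GRing.Theory Num.Theory.
Import numFieldNormedType.Exports.

Local Open Scope classical_set_scope.
Local Open Scope ring_scope.

(** * Polygons in the plane *)

Section plane_vectors.
Context {F : realFieldType}.
Implicit Types a b c p q : F.

(** By Lagrange's identity the determinant of [u] and [b] is nonzero, and Cramer's rule recovers [w]
    from its two inner products. This is where dimension two enters. *)
Lemma orthogonal_basis_eq0 (u1 u2 b1 b2 w1 w2 : F) :
  u1 ^+ 2 + u2 ^+ 2 != 0 -> b1 ^+ 2 + b2 ^+ 2 != 0 -> u1 * b1 + u2 * b2 = 0 ->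
  w1 * u1 + w2 * u2 = 0 -> w1 * b1 + w2 * b2 = 0 -> w1 = 0 /\ w2 = 0.
Proof.
move=> u0 b0 ub wu wb.
have det0 : u1 * b2 - u2 * b1 != 0.
  apply: contraNneq (mulf_neq0 u0 b0) => det0; apply/eqP.
  transitivity ((u1 * b2 - u2 * b1) ^+ 2 + (u1 * b1 + u2 * b2) ^+ 2); first ring.
  by rewrite det0 ub; ring.
split; apply/eqP; rewrite -(mulIr_eq0 _ (mulIf det0)); apply/eqP.
  transitivity ((w1 * u1 + w2 * u2) * b2 - (w1 * b1 + w2 * b2) * u2); first ring.
  by rewrite wu wb; ring.
transitivity ((w1 * b1 + w2 * b2) * u1 - (w1 * u1 + w2 * u2) * b1); first ring.
by rewrite wu wb; ring.
Qed.

Lemma sqr_sum_eq0 a b : a ^+ 2 + b ^+ 2 = 0 -> a = 0 /\ b = 0.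
Proof.
move/eqP; rewrite paddr_eq0 ?sqr_ge0// !sqrf_eq0.
by case/andP => /eqP -> /eqP ->.
Qed.

(** Vectors of equal length making equal angles with [b] either coincide or are mirror images in the
    line of [b]. The candidate difference is orthogonal both to [b] and to the difference of the two
    vectors, which is nonzero by the last hypothesis. *)
Lemma reflected_vector (L c a1 a2 b1 b2 c1 c2 : F) : L != 0 ->
  a1 ^+ 2 + a2 ^+ 2 = L -> b1 ^+ 2 + b2 ^+ 2 = L -> c1 ^+ 2 + c2 ^+ 2 = L ->
  a1 * b1 + a2 * b2 = c -> b1 * c1 + b2 * c2 = c -> a1 * c1 + a2 * c2 != L ->
  c1 = 2 * (c / L) * b1 - a1 /\ c2 = 2 * (c / L) * b2 - a2.
Proof.
move=> L0 aa bb cc ab bc ac.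
have cL : 2 * (c / L) * L = 2 * c by field.
have [] := @orthogonal_basis_eq0 (c1 - a1) (c2 - a2) b1 b2
  (c1 + a1 - 2 * (c / L) * b1) (c2 + a2 - 2 * (c / L) * b2).
- apply: contraNneq ac => e.
  apply/eqP; move: e; rewrite !sqrrB; lra.
- by rewrite bb.
- lra.
- transitivity ((c1 ^+ 2 + c2 ^+ 2) - (a1 ^+ 2 + a2 ^+ 2)
    - 2 * (c / L) * ((b1 * c1 + b2 * c2) - (a1 * b1 + a2 * b2))); first ring.
  by rewrite aa cc ab bc; ring.
- transitivity ((b1 * c1 + b2 * c2) + (a1 * b1 + a2 * b2)
    - 2 * (c / L) * (b1 ^+ 2 + b2 ^+ 2)); first ring.
  by rewrite bb ab bc cL; ring.
- by move=> e1 e2; split; lra.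
Qed.

(** Summing the recurrence telescopes: [(2c - 2)(q k.+1 - q 1)] is a combination of four edges, each
    bounded by [M], and [c != 1] permits division. *)
Lemma bounded_recurrence (q : nat -> F) (c M : F) : c != 1 ->
  (forall k, `|q k.+1 - q k| <= M) ->
  (forall k, q k.+3 - q k.+2 = 2 * c * (q k.+2 - q k.+1) - (q k.+1 - q k)) ->
  exists C, forall k, `|q k| <= C.
Proof.
move=> c1 qM qrec.
have c0 : 2 * c - 2 != 0 by apply: contraNneq c1 => ?; apply/eqP; lra.
have tele k : (2 * c - 2) * (q k.+1 - q 1%N)
    = (q k.+2 - q k.+1) - (q k.+1 - q k) - ((q 2%N - q 1%N) - (q 1%N - q 0%N)).
  elim: k => [|k IH]; first ring.
  rewrite qrec.
  transitivity ((2 * c - 2) * (q k.+1 - q 1%N) + (2 * c - 2) * (q k.+2 - q k.+1)).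
    by ring.
  by rewrite IH; ring.
have qE k : q k.+1 = q 1%N + (2 * c - 2)^-1 *
   ((q k.+2 - q k.+1) - (q k.+1 - q k) - ((q 2%N - q 1%N) - (q 1%N - q 0%N))).
  by rewrite -tele mulKf//; ring.
have M0 : 0 <= M := le_trans (normr_ge0 _) (qM 0%N).
exists (`|q 0%N| + (`|q 1%N| + `|(2 * c - 2)^-1| * (4 * M))) => -[|k].
  by rewrite lerDl addr_ge0// mulr_ge0// mulr_ge0.
apply: ler_wpDl => //; rewrite [in leLHS]qE.
rewrite (le_trans (ler_normD _ _))// lerD2l normrM ler_wpM2l//.
have h1 := qM k.+1; have h2 := qM k; have h3 := qM 1%N; have h4 := qM 0%N.
rewrite (le_trans (ler_normB _ _))//.
have := ler_normB (q k.+2 - q k.+1) (q k.+1 - q k).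
have := ler_normB (q 2%N - q 1%N) (q 1%N - q 0%N).
lra.
Qed.

(** In complex notation [b = (conj(a) b) a / L], where [conj(a) b] has the inner product as real
    part and the cross product as imaginary part. *)
Lemma rotation_step (L a1 a2 b1 b2 : F) : L != 0 -> a1 ^+ 2 + a2 ^+ 2 = L ->
  b1 = ((a1 * b1 + a2 * b2) * a1 - (a1 * b2 - a2 * b1) * a2) / L /\
  b2 = ((a1 * b1 + a2 * b2) * a2 + (a1 * b2 - a2 * b1) * a1) / L.
Proof. by move=> L0 aL; split; rewrite -aL; field; rewrite aL. Qed.

End plane_vectors.

(** * Curves with equal adjacent chords *)

(** Squared, so that the geometric identities below are polynomial in the coordinates. *)
Definition dist2 (R : realType) (X Y : R -> R) (a b : R) : R :=
  (X a - X b) ^+ 2 + (Y a - Y b) ^+ 2.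

Lemma cvg_sqr_dist (R : realType) (T : Type) (F : set_system T) {FF : Filter F}
    (f1 g1 f2 g2 : T -> R) (a b c d : R) :
  f1 @ F --> a -> g1 @ F --> b -> f2 @ F --> c -> g2 @ F --> d ->
  (f1 n - g1 n) ^+ 2 + (f2 n - g2 n) ^+ 2 @[n --> F] --> (a - b) ^+ 2 + (c - d) ^+ 2.
Proof.
move=> fa gb fc gd; rewrite !expr2; under eq_fun do rewrite !expr2.
by apply: cvgD; apply: cvgM; apply: cvgB.
Qed.

Section plane_curve.
Context {R : realType} (X Y : R -> R).

Lemma dist2C a b : dist2 X Y a b = dist2 X Y b a.
Proof. by rewrite /dist2; ring. Qed.

Lemma dist2xx a : dist2 X Y a a = 0.
Proof. by rewrite /dist2; ring. Qed.

Lemma dist2_ge0 a b : 0 <= dist2 X Y a b.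
Proof. by rewrite addr_ge0 ?sqr_ge0. Qed.

End plane_curve.

Section rigidity.
Context {R : realType} (X Y : R -> R).
Local Notation d2 := (dist2 X Y).
Context (X_cont : continuous X) (Y_cont : continuous Y).
Context (d2_mid : forall x u, d2 x (x + u) = d2 x (x - u)).
Context (d2_neq0 : forall a b, a != b -> d2 a b != 0).
Context (d2_unbounded : forall x u B, 0 < u ->
  exists k : nat, B < d2 x (x + u * k%:R)).

Let d2_step a b c : b - a = c - b -> d2 a b = d2 b c.
Proof.
move=> e; have := d2_mid b (c - b).
by rewrite -{2}e !subrKC opprB subrKC [d2 b a]dist2C => ->.
Qed.

(** All edges along the progression have the same length, so [bounded_recurrence] would confine both
    coordinates, against [d2_unbounded]. *)
Let no_recurrence x w c : 0 < w -> c != 1 ->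
  let q (k : nat) := x + w * k%:R in
  (forall k, X (q k.+3) - X (q k.+2)
    = 2 * c * (X (q k.+2) - X (q k.+1)) - (X (q k.+1) - X (q k))) ->
  (forall k, Y (q k.+3) - Y (q k.+2)
    = 2 * c * (Y (q k.+2) - Y (q k.+1)) - (Y (q k.+1) - Y (q k))) -> False.
Proof.
move=> w0 c1 q Xrec Yrec.
have qS k : d2 (q k.+1) (q k) = d2 x (x + w).
  elim: k => [|k <-]; first by rewrite dist2C /q mulr0 addr0 mulr1.
  by rewrite dist2C [RHS]dist2C; apply/esym/d2_step; rewrite /q -!natr1; ring.
have sqr_le (z z' : R) : z ^+ 2 + z' ^+ 2 = d2 x (x + w) -> `|z| <= d2 x (x + w) + 1.
  by move=> <-; case: (ler0P z) => ?; have := sqr_ge0 (z + 1); have := sqr_ge0 (z - 1);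
       have := sqr_ge0 z; have := sqr_ge0 z'; lra.
have [CX hX] : exists C, forall k, `|X (q k)| <= C.
  apply: (@bounded_recurrence _ _ c (d2 x (x + w) + 1) c1 _ Xrec) => k.
  exact: sqr_le (qS k).
have [CY hY] : exists C, forall k, `|Y (q k)| <= C.
  apply: (@bounded_recurrence _ _ c (d2 x (x + w) + 1) c1 _ Yrec) => k.
  by apply: sqr_le; rewrite addrC; exact: (qS k).
have [k] := @d2_unbounded x w ((CX + CX) ^+ 2 + (CY + CY) ^+ 2) w0.
apply/negP; rewrite -leNgt.
have x0 : x = q 0%N by rewrite /q mulr0 addr0.
have le2 (z z' C : R) : `|z| <= C -> `|z'| <= C -> (z - z') ^+ 2 <= (C + C) ^+ 2.
  move=> hz hz'; rewrite -(real_normK (num_real (z - z'))).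
  have := ler_normB z z'; have := normr_ge0 (z - z'); nra.
rewrite -/(q k) {1}x0; apply: lerD; exact: le2.
Qed.

Definition midpoint_at x u :=
  X (x + u) + X (x - u) = 2 * X x /\ Y (x + u) + Y (x - u) = 2 * Y x.

Let midpointN x u : midpoint_at x u -> midpoint_at x (- u).
Proof. by case=> eX eY; split; rewrite opprK addrC. Qed.

(** With edges of length [l], the chord from [x - u] to [x + u] has length [2 l], hence so has the
    next chord over [2 u]. Equality in the triangle inequality, in the form of the parallelogram
    law, makes its middle vertex a midpoint. *)
Let midpointS x u : midpoint_at x u -> midpoint_at (x + 2 * u) u.
Proof.
case=> eX eY; rewrite /midpoint_at.
have -> : x + 2 * u - u = x + u by ring.
have h1 : d2 (x - u) x = d2 x (x + u) by apply: d2_step; ring.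
have h2 : d2 x (x + u) = d2 (x + u) (x + 2 * u) by apply: d2_step; ring.
have h3 : d2 (x + u) (x + 2 * u) = d2 (x + 2 * u) (x + 2 * u + u).
  by apply: d2_step; ring.
have h4 : d2 (x - u) (x + u) = d2 (x + u) (x + 2 * u + u).
  by apply: d2_step; ring.
rewrite /dist2 in h1 h2 h3 h4.
set x0 := X (x - u) in eX h1 h4 *; set y0 := Y (x - u) in eY h1 h4 *.
set x1 := X x in eX h1 h2 *; set y1 := Y x in eY h1 h2 *.
set x2 := X (x + u) in eX h1 h2 h3 h4 *; set y2 := Y (x + u) in eY h1 h2 h3 h4 *.
set x3 := X (x + 2 * u) in h2 h3 *; set y3 := Y (x + 2 * u) in h2 h3 *.
set x4 := X _ in h3 h4 *; set y4 := Y _ in h3 h4 *.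
have [] := @sqr_sum_eq0 _ (x4 + x2 - 2 * x3) (y4 + y2 - 2 * y3); last by lra.
have {}eX : x0 = 2 * x1 - x2 by lra.
have {}eY : y0 = 2 * y1 - y2 by lra.
rewrite eX eY in h4; lra.
Qed.

Let midpoint_shift x u (k : nat) : midpoint_at x u -> midpoint_at (x - 2 * u * k%:R) u.
Proof.
move=> mx; elim: k => [|k IH]; first by rewrite mulr0 subr0.
have := midpointN (midpointS (midpointN IH)); rewrite opprK.
by congr midpoint_at; rewrite -natr1; ring.
Qed.

(** The cross product of the two edges meeting at the vertex [x]; its sign is the direction of
    turning. *)
Let turn u x := (X x - X (x - u)) * (Y (x + u) - Y x)
  - (Y x - Y (x - u)) * (X (x + u) - X x).

(** Parallel edges of equal length are equal or opposite; opposite ones would identify [x - u] with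
    [x + u], against injectivity. *)
Let turn_eq0 u x : u != 0 -> turn u x = 0 -> midpoint_at x u.
Proof.
move=> u0; rewrite /turn.
have := @d2_neq0 (x - u) x; have := @d2_neq0 (x - u) (x + u).
have : d2 (x - u) x = d2 x (x + u) by apply: d2_step; ring.
rewrite /midpoint_at /dist2.
set x0 := X (x - u); set y0 := Y (x - u); set x1 := X x; set y1 := Y x.
set x2 := X _; set y2 := Y _ => e01 n02 n01 cr.
have {}n02 : (x0 - x2) ^+ 2 + (y0 - y2) ^+ 2 != 0.
  by apply: n02; apply: contra u0 => /eqP ?; apply/eqP; lra.
have {}n01 : (x1 - x0) ^+ 2 + (y1 - y0) ^+ 2 != 0.
  rewrite -[_ + _](_ : (x0 - x1) ^+ 2 + (y0 - y1) ^+ 2 = _); last ring.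
  by apply: n01; apply: contra u0 => /eqP ?; apply/eqP; lra.
have [w0 w1] : (x2 - x1) - (x1 - x0) = 0 /\ (y2 - y1) - (y1 - y0) = 0.
  apply: (@orthogonal_basis_eq0 _ (x2 - x0) (y2 - y0) (- (y1 - y0)) (x1 - x0)).
  - by apply: contraNneq n02 => e; apply/eqP; lra.
  - by rewrite sqrrN addrC.
  - lra.
  - lra.
  - lra.
by split; lra.
Qed.

Let turn_cont u : continuous (turn u).
Proof.
move=> x; have XYc (Z : R -> R) v : continuous Z -> {for x, continuous (fun z => Z (z + v))}.
  move=> Zc; apply: (@continuous_comp _ _ _ (fun z => z + v) Z); last exact: Zc.
  by apply: cvgD; [exact: cvg_id | exact: cvg_cst].
apply: cvgB; apply: cvgM; apply: cvgB; by [exact: X_cont | exact: Y_cont | exact: XYc].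
Qed.

Let turn_same_sign u x0 : (forall x, x0 <= x -> turn u x != 0) ->
  forall x y, x0 <= x -> x0 <= y -> 0 < turn u x * turn u y.
Proof.
move=> H; suff W x y : x0 <= x -> x <= y -> 0 < turn u x * turn u y.
  move=> x y x0x x0y; have [xy|/ltW yx] := leP x y; first exact: W.
  by rewrite mulrC; exact: W.
move=> x0x xy; rewrite lt_neqAle eq_sym mulf_neq0 ?H//=; last exact: le_trans xy.
rewrite leNgt; apply/negP => neg.
have [||c] := @IVT R (turn u) x y 0 xy; first exact: (continuous_subspaceT (@turn_cont u)).
  rewrite ge_min le_max; have := H x x0x.
  by case: (ltgtP (turn u x) 0) => // h _; case: (lerP (turn u y) 0) => h' //=; nra.
rewrite in_itv/= => /andP[xc _]; apply/eqP; apply: H; exact: le_trans xc.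
Qed.

(* A curve turning always in the same direction at scale [u] would carry the
   progression [x0 + 2 u k] to a polygon invariant under a nontrivial rotation,
   hence bounded. *)
Let exists_midpoint x0 u : 0 < u -> exists2 x, x0 <= x & midpoint_at x u.
Proof.
move=> u0; apply: contrapT => H.
have u_neq0 : u != 0 by rewrite gt_eqF.
have sgn : forall x y, x0 <= x -> x0 <= y -> 0 < turn u x * turn u y.
  apply: turn_same_sign => x x0x; apply/negP => /eqP t0; apply: H.
  by exists x => //; exact: turn_eq0.
pose p (k : nat) := x0 + u * k%:R.
pose a k := X (p k.+1) - X (p k); pose b k := Y (p k.+1) - Y (p k).
pose L := d2 x0 (x0 + u).
have abL k : a k ^+ 2 + b k ^+ 2 = L.
  transitivity (d2 (p k) (p k.+1)); first by rewrite dist2C.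
  elim: k => [|k <-]; first by rewrite /p mulr0 addr0 mulr1.
  by apply/esym/d2_step; rewrite /p -!natr1; ring.
have L0 : L != 0 by apply: d2_neq0; apply: contra u_neq0 => /eqP ?; apply/eqP; lra.
pose d k := a k * a k.+1 + b k * b k.+1.
pose c k := a k * b k.+1 - b k * a k.+1.
have cE k : c k = turn u (p k.+1).
  rewrite /c /a /b /turn.
  have -> : p k.+1 - u = p k by rewrite /p -natr1; ring.
  by have -> : p k.+1 + u = p k.+2 by rewrite /p -!natr1; ring.
have cc j k : 0 < c j * c k.
  by rewrite !cE; apply: sgn; rewrite lerDl mulr_ge0// ltW.
(* A chord over two edges determines their inner product, and adjacent such chords are equal. *)
have dS k : d k.+2 = d k.
  have : d2 (p k) (p k.+2) = d2 (p k.+2) (p k.+4).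
    by apply: d2_step; rewrite /p -!natr1; ring.
  have := abL k; have := abL k.+1; have := abL k.+2; have := abL k.+3.
  by rewrite /d /a /b /dist2; lra.
have dc k : d k ^+ 2 + c k ^+ 2 = L ^+ 2.
  transitivity ((a k ^+ 2 + b k ^+ 2) * (a k.+1 ^+ 2 + b k.+1 ^+ 2)).
    by rewrite /d /c; ring.
  by rewrite !abL expr2.
(* The relation [dc] fixes [c] up to sign, and the sign never changes. *)
have cS k : c k.+2 = c k.
  have : c k.+2 ^+ 2 == c k ^+ 2.
    by apply/eqP; have := dc k; have := dc k.+2; rewrite dS; lra.
  by rewrite eqf_sqr => /orP[/eqP//|/eqP e]; have := cc k.+2 k; rewrite e; nra.
(* [P + i Q] is the product of two consecutive rotations. As [d] and [c] have period two and
   rotations commute, it is the same from every vertex. *)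
pose P := (d 0%N * d 1%N - c 0%N * c 1%N) / L ^+ 2.
pose Q := (d 0%N * c 1%N + c 0%N * d 1%N) / L ^+ 2.
have PQ k : P = (d k * d k.+1 - c k * c k.+1) / L ^+ 2 /\
            Q = (d k * c k.+1 + c k * d k.+1) / L ^+ 2.
  elim: k => [|k [-> ->]]; first by [].
  by rewrite dS cS; split; congr (_ / _); ring.
have PQ1 : P ^+ 2 + Q ^+ 2 = 1.
  transitivity ((d 0%N ^+ 2 + c 0%N ^+ 2) * (d 1%N ^+ 2 + c 1%N ^+ 2) / L ^+ 4).
    by rewrite /P /Q; field.
  by rewrite !dc; field.
(* Were [P = 1], the two rotations would be inverse to each other, so [c 0] and [c 1] would have
   opposite signs. *)
have P1 : P != 1.
  apply/eqP => P1.
  have e : d 0%N * d 1%N - c 0%N * c 1%N = L ^+ 2.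
    by rewrite -[RHS]mul1r -P1 /P mulfVK// expf_neq0.
  have [|_] := @sqr_sum_eq0 _ (d 0%N - d 1%N) (c 0%N + c 1%N).
    by have := dc 0%N; have := dc 1%N; lra.
  by have := cc 0%N 1%N; nra.
have ab2 k : a k.+2 = P * a k - Q * b k /\ b k.+2 = P * b k + Q * a k.
  have [-> ->] := PQ k.
  have [a1 b1] := rotation_step (a k.+1) (b k.+1) L0 (abL k).
  have [a2 b2] := rotation_step (a k.+2) (b k.+2) L0 (abL k.+1).
  rewrite -/(d k) -/(c k) in a1 b1; rewrite -/(d k.+1) -/(c k.+1) in a2 b2.
  by rewrite a2 b2 a1 b1; split; field.
(* Cayley-Hamilton for the rotation by [P + i Q], of trace [2 P] and determinant 1. *)
have ab4 k : a k.+4 = 2 * P * a k.+2 - a k /\ b k.+4 = 2 * P * b k.+2 - b k.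
  have [a2 b2] := ab2 k; have [-> ->] := ab2 k.+2.
  have -> : a k = (P ^+ 2 + Q ^+ 2) * a k by rewrite PQ1 mul1r.
  have -> : b k = (P ^+ 2 + Q ^+ 2) * b k by rewrite PQ1 mul1r.
  by rewrite a2 b2; split; ring.
pose q (k : nat) := x0 + 2 * u * k%:R.
have qE k : q k = p (2 * k)%N by rewrite /q /p natrM; ring.
have two_steps (Z : R -> R) j : Z (p j.+2) - Z (p j)
    = (Z (p j.+2) - Z (p j.+1)) + (Z (p j.+1) - Z (p j)) by ring.
have idx k : (2 * k.+1)%N = (2 * k).+2 by rewrite mulnS.
apply: (@no_recurrence x0 (2 * u) P) => //; first by rewrite mulr_gt0.
  move=> k; rewrite -!/(q _) !qE !idx !(two_steps X) -!/(a _).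
  by have [-> _] := ab4 (2 * k)%N; have [-> _] := ab4 (2 * k).+1; ring.
move=> k; rewrite -!/(q _) !qE !idx !(two_steps Y) -!/(b _).
by have [_ ->] := ab4 (2 * k)%N; have [_ ->] := ab4 (2 * k).+1; ring.
Qed.

(** The parameters [m k] mark the midpoints of the edges of the polygon [q]. Chords among vertices
    and edge midpoints express the inner products [c] and [g] of edges one and two apart, and both
    turn out to be constant. *)
Let midpoint_progression x u : 0 < u -> midpoint_at x u ->
  forall k : nat, d2 (x + u) (x + u + 4 * u * k%:R)
    = k%:R ^+ 2 * d2 (x + u) (x + u + 4 * u).
Proof.
move=> u0 mx.
pose q (k : nat) := x + u + 2 * u * k%:R.
pose m (k : nat) := x + 2 * u + 2 * u * k%:R.
pose a k := X (q k.+1) - X (q k); pose b k := Y (q k.+1) - Y (q k).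
pose L := d2 (x + u) (x + u + 2 * u).
have mE k : X (m k) = (X (q k) + X (q k.+1)) / 2 /\ Y (m k) = (Y (q k) + Y (q k.+1)) / 2.
  have : midpoint_at (m k) u.
    elim: k => [|k IH]; first by rewrite /m mulr0 addr0; exact: midpointS.
    by have := midpointS IH; congr midpoint_at; rewrite /m -natr1; ring.
  rewrite /midpoint_at.
  have -> : m k + u = q k.+1 by rewrite /m /q -natr1; ring.
  by have -> : m k - u = q k by [rewrite /m /q; ring]; lra.
have abL k : a k ^+ 2 + b k ^+ 2 = L.
  transitivity (d2 (q k) (q k.+1)); first by rewrite dist2C.
  elim: k => [|k <-]; first by rewrite /q mulr0 addr0 mulr1.
  by apply/esym/d2_step; rewrite /q -!natr1; ring.
have L0 : L != 0.
  by apply: d2_neq0; have := gt_eqF u0; apply: contraFN => /eqP ?; apply/eqP; lra.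
pose c k := a k * a k.+1 + b k * b k.+1.
pose g k := a k * a k.+2 + b k * b k.+2.
have cS k : c k.+1 = c k.
  have : d2 (m k) (m k.+1) = d2 (m k.+1) (m k.+2).
    by apply: d2_step; rewrite /m -!natr1; ring.
  have := abL k; have := abL k.+1; have := abL k.+2.
  have [e0 f0] := mE k; have [e1 f1] := mE k.+1; have [e2 f2] := mE k.+2.
  by rewrite /dist2 e0 f0 e1 f1 e2 f2 /c /a /b; lra.
have g2 k : g k.+2 = g k.
  have : d2 (m k) (m k.+2) = d2 (m k.+2) (m k.+4).
    by apply: d2_step; rewrite /m -!natr1; ring.
  have := abL k; have := abL k.+1; have := abL k.+2; have := abL k.+3; have := abL k.+4.
  have := cS k; have := cS k.+1; have := cS k.+2.
  have [e0 f0] := mE k; have [e2 f2] := mE k.+2; have [e4 f4] := mE k.+4.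
  by rewrite /dist2 e0 f0 e2 f2 e4 f4 /g /c /a /b; lra.
(* A chord over [5 u] joins an edge midpoint to a vertex. Periods two and three together make [g]
   constant. *)
have g3 k : g k.+3 = g k.
  have : d2 (m k) (q k.+3) = d2 (q k.+3) (m k.+4.+1).
    by apply: d2_step; rewrite /m /q -!natr1; ring.
  have := abL k; have := abL k.+1; have := abL k.+2; have := abL k.+3; have := abL k.+4.
  have := abL k.+4.+1; have := cS k; have := cS k.+1; have := cS k.+2; have := cS k.+3.
  have [e0 f0] := mE k; have [e5 f5] := mE k.+4.+1.
  by rewrite /dist2 e0 f0 e5 f5 /g /c /a /b; lra.
have cE k : c k = c 0%N by elim: k => // k <-.
have gE k : g k = g 0%N by elim: k => // k <-; rewrite -g3 g2.
(* If [g] differs from [L], each edge is the reflection of the one two before it, and the polygon is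
   bounded. If [g = L], edges two apart coincide. *)
have [gL|gL] := eqVneq (g 0%N) L; last first.
  exfalso.
  have c1 : c 0%N / L != 1.
    apply: contraNneq gL => cL.
    have {}cL k : c k = L by rewrite cE -[RHS]mul1r -cL mulfVK.
    have ab k : a k.+1 = a k /\ b k.+1 = b k.
      have [|? ?] := @sqr_sum_eq0 _ (a k.+1 - a k) (b k.+1 - b k).
        by have := cL k; have := abL k; have := abL k.+1; rewrite /c; lra.
      by split; lra.
    have [a1 b1] := ab 0%N; have [a2 b2] := ab 1%N.
    by rewrite /g a2 b2 a1 b1 -(abL 0%N); apply/eqP; ring.
  have ab k : a k.+2 = 2 * (c 0%N / L) * a k.+1 - a k /\
              b k.+2 = 2 * (c 0%N / L) * b k.+1 - b k.
    apply: reflected_vector; rewrite ?abL//; [exact: cE|exact: (cE k.+1)|].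
    by rewrite -/(g k) gE.
  apply: (@no_recurrence (x + u) (2 * u) (c 0%N / L)) => //; first by rewrite mulr_gt0.
    by move=> k; have [] := ab k.
  by move=> k; have [] := ab k.
have ab k : a k.+2 = a k /\ b k.+2 = b k.
  have [|? ?] := @sqr_sum_eq0 _ (a k.+2 - a k) (b k.+2 - b k).
    by have := gE k; have := abL k; have := abL k.+2; rewrite gL /g; lra.
  by split; lra.
have abE k : (a (2 * k)%N = a 0%N /\ b (2 * k)%N = b 0%N) /\
    (a (2 * k).+1%N = a 1%N /\ b (2 * k).+1%N = b 1%N).
  elim: k => [//|k [[e0 f0] [e1 f1]]]; rewrite mulnS !add2n.
  by have [-> ->] := ab (2 * k)%N; have [-> ->] := ab (2 * k).+1.
have qE k : X (q (2 * k)%N) - X (q 0%N) = k%:R * (a 0%N + a 1%N) /\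
            Y (q (2 * k)%N) - Y (q 0%N) = k%:R * (b 0%N + b 1%N).
  elim: k => [|k [e f]]; first by rewrite !mul0r !muln0 !subrr.
  have [[e0 f0] [e1 f1]] := abE k; rewrite mulnS !add2n -natr1; split.
    transitivity ((X (q (2 * k)%N) - X (q 0%N)) + (a (2 * k)%N + a (2 * k).+1)).
      by rewrite /a; ring.
    by rewrite e e0 e1; ring.
  transitivity ((Y (q (2 * k)%N) - Y (q 0%N)) + (b (2 * k)%N + b (2 * k).+1)).
    by rewrite /b; ring.
  by rewrite f f0 f1; ring.
move=> k; have [eX eY] := qE k; have [e1 f1] := qE 1%N.
have -> : x + u + 4 * u * k%:R = q (2 * k)%N by rewrite /q natrM; ring.
have -> : x + u + 4 * u = q (2 * 1)%N by rewrite /q; ring.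
have -> : x + u = q 0%N by rewrite /q mulr0 addr0.
rewrite dist2C [in RHS]dist2C /dist2 eX eY e1 f1; ring.
Qed.

Lemma exists_homogeneous_progression w : 0 < w -> exists2 y, 0 <= y <= w &
  forall k : nat, d2 y (y + w * k%:R) = k%:R ^+ 2 * d2 y (y + w).
Proof.
move=> w0; pose u := w / 4; have u0 : 0 < u by rewrite divr_gt0.
have uw : 4 * u = w by rewrite /u; field.
have [x x0 mx] := exists_midpoint 0 u0.
(* Steps of [2 u] bring the midpoint parameter back into [[0, 2u)], so that [x' + u] stays below
   [3 u < w]. *)
pose k := Num.truncn (x / (2 * u)); pose x' := x - 2 * u * k%:R.
have u2 : 0 < 2 * u by rewrite mulr_gt0.
have /andP[k1 k2] : k%:R <= x / (2 * u) < k.+1%:R.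
  by apply: truncn_itv; rewrite divr_ge0// ltW.
rewrite ler_pdivlMr// in k1; rewrite ltr_pdivrMr// -natr1 in k2.
exists (x' + u); first by rewrite /x'; apply/andP; split; lra.
by move=> j; rewrite -uw; apply: midpoint_progression => //; exact: midpoint_shift.
Qed.

(** On a homogeneous progression of step [1 / (n + 1)], both 1 and the rounding [r n] of [t] are
    multiples of the step, which gives the identity for [r n] at the base point [y n]. Continuity
    yields the limit, as [y n] tends to 0 and [r n] to [t]. *)
Lemma dist2_homogeneous s : d2 0 s = s ^+ 2 * d2 0 1.
Proof.
suff W t : 0 <= t -> d2 0 t = t ^+ 2 * d2 0 1.
  have [/W//|/ltW s0] := lerP 0 s.
  have := d2_mid 0 (- s); rewrite opprK !add0r => <-.
  by rewrite W ?oppr_ge0// sqrrN.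
move=> t0; pose w (n : nat) : R := n.+1%:R^-1.
have w0 n : 0 < w n by rewrite invr_gt0.
have /choice[y yP] n : exists y, 0 <= y <= w n /\
    forall k : nat, d2 y (y + w n * k%:R) = k%:R ^+ 2 * d2 y (y + w n).
  by have [y ? ?] := exists_homogeneous_progression (w0 n); exists y.
pose r n : R := w n * (Num.truncn (t * n.+1%:R))%:R.
have wn n : w n * n.+1%:R = 1 by rewrite /w mulVf.
have rP n : t - w n <= r n <= t.
  have /andP[k1 k2] := truncn_itv (mulr_ge0 t0 (ler0n R n.+1)).
  rewrite /r; move: (Num.truncn _) k1 k2 => j k1 k2.
  have -> : t = w n * (t * n.+1%:R) by rewrite mulrCA wn mulr1.
  rewrite -[X in _ - X]mulr1 -mulrBr !ler_pM2l// lerBlDr k1 andbT ltW//.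
  by move: k2; rewrite -[j.+1%:R]natr1.
have eqn n : d2 (y n) (y n + r n) = r n ^+ 2 * d2 (y n) (y n + 1).
  have [_ yn] := yP n.
  have := yn n.+1; rewrite wn => e1.
  by rewrite /r yn e1 mulrA -exprMn [w n * _ * _]mulrAC wn mul1r.
have w_cvg : w n @[n --> \oo] --> (0 : R) by exact: cvg_harmonic.
have y_cvg : y n @[n --> \oo] --> (0 : R).
  apply: (squeeze_cvgr _ (cvg_cst 0) w_cvg).
  by apply/nearW => n; have [] := yP n.
have r_cvg : r n @[n --> \oo] --> t.
  apply: (@squeeze_cvgr _ _ _ _ (fun n => t - w n) (fun=> t)).
  - exact/nearW.
  - by rewrite -[X in _ --> X]subr0; apply: cvgB => //; exact: cvg_cst.
  - exact: cvg_cst.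
have d2_cvg (v : R ^nat) l : v n @[n --> \oo] --> l ->
    d2 (y n) (y n + v n) @[n --> \oo] --> d2 0 l.
  move=> vl; have yvl : y n + v n @[n --> \oo] --> l.
    by rewrite -[l]add0r; exact: cvgD.
  by apply: cvg_sqr_dist; apply: continuous_cvg => //;
    by [exact: X_cont | exact: Y_cont].
have h1 := d2_cvg _ _ r_cvg.
have h2 : d2 (y n) (y n + r n) @[n --> \oo] --> t ^+ 2 * d2 0 1.
  under eq_fun do rewrite eqn.
  apply: cvgM; last by apply: d2_cvg; exact: cvg_cst.
  by rewrite expr2; under eq_fun do rewrite expr2; exact: cvgM.
exact: (cvg_unique _ h1 h2).
Qed.

End rigidity.

(** * Ultralimits of rescaled curves *)

Lemma fmap_ultra (S T : Type) (f : S -> T) (U : set_system S) :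
  UltraFilter U -> UltraFilter (f @ U).
Proof.
move=> UU; apply: Build_UltraFilter => G GG UG; apply/seteqP; split => // A GA.
have [//|UcA] := in_ultra_setVsetC (f @^-1` A) UU.
have GcA : G (~` A) by exact: UG.
by have [x []] := filter_ex (filterI GA GcA).
Qed.

Lemma bounded_ultra_cvg (R : realType) (T : Type) (U : set_system T)
    {UU : UltraFilter U} (f : T -> R) (B : R) :
  (forall n, `|f n| <= B) -> exists l : R, f @ U --> l.
Proof.
move=> fB; have := @segment_compact R (- B) B.
rewrite compact_ultra => /(_ (f @ U) _) [| |l [_ fl]]; last by exists l.
  exact: fmap_ultra.
by apply: nearW => n; rewrite /= in_itv/= -ler_norml.
Qed.

(** Quasisymmetry of [h] seen from its inverse: [d] is the squared distance on the curve, so [t]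
    bounds a squared ratio. Written without quotients, it covers coincident points and is invariant
    under rescaling. *)
Definition quasi_control (R : realType) (d : R -> R -> R) (t k : R) : Prop :=
  forall a b x, d a x <= t * d b x -> `|a - x| <= k * `|b - x|.

Section blow_up.
Context {R : realType} (X Y : nat -> R -> R).
Local Notation d n := (dist2 (X n) (Y n)).
Context (X0 : forall n, X n 0 = 0) (Y0 : forall n, Y n 0 = 0).
Context (d10 : forall n, d n 1 0 = 1).
Context (d_small : forall k, 0 < k ->
  exists2 t, 0 < t & forall n, quasi_control (d n) t k).
Context (d_large : forall t, exists2 k, 0 < k & forall n, quasi_control (d n) t k).
Context (d_mid : forall eps B, 0 < eps -> \forall n \near \oo, forall x u,
  d n x (x + u) <= B -> d n x (x - u) <= (1 + eps) * d n x (x + u)).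

(** The point 1 stays at distance 1 from 0; if [p] went too far, [d_small] would give
    [1 <= |p| / (|p| + 1)]. *)
Let d_bounded p : exists B, forall n, d n p 0 <= B.
Proof.
have p0 : 0 < `|p| + 1 by rewrite ltr_wpDl.
have [t t0 tP] := d_small (divr_gt0 ltr01 p0).
exists t^-1 => n; rewrite leNgt; apply/negP => h.
have := tP n 1 p 0; rewrite d10 !subr0 normr1 => /(_ _)/wrap[].
  by rewrite mulrC -ler_pdivrMr// mul1r ltW.
by apply/negP; rewrite -ltNge mul1r mulrC ltr_pdivrMr// mul1r ltrDl.
Qed.

Let coordinates_bounded p : exists B, forall n, `|X n p| <= B /\ `|Y n p| <= B.
Proof.
have [B hB] := d_bounded p; exists (B + 1) => n.
have := hB n; rewrite /dist2 X0 Y0 !subr0 => h.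
by split; [case: (ler0P (X n p))|case: (ler0P (Y n p))] => _;
  have := sqr_ge0 (X n p); have := sqr_ge0 (Y n p);
  have := sqr_ge0 (X n p + 1); have := sqr_ge0 (Y n p + 1);
  have := sqr_ge0 (X n p - 1); have := sqr_ge0 (Y n p - 1); lra.
Qed.

(** The limit curve satisfies the hypotheses of [dist2_homogeneous], so at [w = lim y n] its squared
    distance from the origin is [w ^+ 2], which is at least [c] and at most [T]. *)
Lemma blow_up_limit (y : nat -> R) (K T c : R) : (forall n, `|y n| <= K) ->
  (forall n, d n (y n) 0 <= T) -> (forall n, c <= y n ^+ 2) -> c <= T.
Proof.
move=> yK yT yc.
(* One ultrafilter finer than [\oo] makes the curves converge at every real parameter at once. *)
have [U [UU oU]] := @ultraFilterLemma nat \oo _.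
have /choice[x xP] (p : R) : exists l : R, X n p @[n --> U] --> l.
  have [B hB] := coordinates_bounded p.
  by apply: (@bounded_ultra_cvg _ _ U _ _ B) => n; have [] := hB n.
have /choice[z zP] (p : R) : exists l : R, Y n p @[n --> U] --> l.
  have [B hB] := coordinates_bounded p.
  by apply: (@bounded_ultra_cvg _ _ U _ _ B) => n; have [] := hB n.
have [w wP] := bounded_ultra_cvg yK.
pose e := dist2 x z.
have eP p q : d n p q @[n --> U] --> e p q by exact: cvg_sqr_dist.
have e10 : e 1 0 = 1.
  have h : d n 1 0 @[n --> U] --> (1 : R).
    by under eq_fun do rewrite d10; exact: cvg_cst.
  exact: (cvg_unique _ (eP 1 0) h).
(* A strict inequality between limits already holds at some index, and the conclusion does not
   involve the curve. *)
have e_control t k : (forall n, quasi_control (d n) t k) ->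
    forall a b p, e a p < t * e b p -> `|a - p| <= k * `|b - p|.
  move=> dk a b p lt_e.
  have h : d n a p - t * d n b p @[n --> U] --> e a p - t * e b p.
    by apply: cvgB => //; apply: cvgM => //; exact: cvg_cst.
  have : \forall n \near U, d n a p - t * d n b p < 0.
    by apply: (cvgr_lt _ h); rewrite subr_lt0.
  by move=> /filter_ex[n]; rewrite subr_lt0 => /ltW; exact: dk.
(* The point [p + 1] is the yardstick: if [q] were carried further than [eta] from [p], control
   would force [1 <= k |q - p|]. *)
have e_near p eta : 0 < eta -> exists2 r, 0 < r & forall q, `|q - p| < r -> e q p <= eta.
  move=> eta0; have [k k0 kP] := d_large ((e (p + 1) p + 1) / eta).
  exists k^-1; first by rewrite invr_gt0.
  move=> q; rewrite -[k^-1]mul1r ltr_pdivlMr// leNgt => qp; apply/negP => lt_eta.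
  have := e_control _ _ kP (p + 1) q p.
  rewrite [p + 1 - p]addrAC subrr add0r normr1 => /(_ _)/wrap[].
    rewrite mulrAC ltr_pdivlMr//.
    have := dist2_ge0 x z (p + 1) p; rewrite -/(e _ _); nra.
  by apply/negP; rewrite -ltNge mulrC.
have sqr_le (a b r : R) : 0 < r -> a ^+ 2 + b ^+ 2 <= r ^+ 2 -> `|a| <= r /\ `|b| <= r.
  move=> r0 h; split; rewrite -(@ler_pXn2r _ 2)// ?nnegrE// ?(ltW r0)//
    real_normK ?num_real//; by have := sqr_ge0 a; have := sqr_ge0 b; lra.
have x_cont : continuous x.
  move=> p; apply/cvgrPdist_le => eta eta0.
  have [r r0 rP] := e_near p _ (exprn_gt0 2 eta0).
  near=> q; have [|qx _] := @sqr_le (x q - x p) (z q - z p) eta eta0; last by rewrite distrC.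
  by apply: rP; rewrite distrC; near: q; exact: cvgr_dist_lt.
have z_cont : continuous z.
  move=> p; apply/cvgrPdist_le => eta eta0.
  have [r r0 rP] := e_near p _ (exprn_gt0 2 eta0).
  near=> q; have [|_ qz] := @sqr_le (x q - x p) (z q - z p) eta eta0; last by rewrite distrC.
  by apply: rP; rewrite distrC; near: q; exact: cvgr_dist_lt.
(* If [a] and [b] had the same image, control against a point [q] with another image would give
   [|a - b| <= |a - b| / 2]. *)
have e_neq0 a b : a != b -> e a b != 0.
  move=> ab; apply/eqP => eab.
  have [q q0] : exists q, 0 < e q b.
    apply: contrapT => /forallNP H.
    have e0 q : x q = x b /\ z q = z b.
      have [|? ?] := @sqr_sum_eq0 _ (x q - x b) (z q - z b).
        by apply/eqP; rewrite eq_le addr_ge0 ?sqr_ge0// andbT leNgt; apply/negP/H.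
      by split; lra.
    have := e10; rewrite /e /dist2; have [-> ->] := e0 1; have [-> ->] := e0 0.
    by rewrite !subrr expr0n addr0 => /eqP; rewrite eq_sym oner_eq0.
  have qb : q != b by apply: contraTneq q0 => ->; rewrite /e dist2xx ltxx.
  have ab0 : 0 < `|a - b| by rewrite normr_gt0 subr_eq0.
  have qb0 : 0 < `|q - b| by rewrite normr_gt0 subr_eq0.
  have [t t0 tP] := d_small (divr_gt0 ab0 (mulr_gt0 (ltr0Sn R 1) qb0)).
  have := e_control _ _ tP a q b; rewrite eab => /(_ (mulr_gt0 t0 q0)).
  rewrite [X in _ <= X -> _](_ : _ = `|a - b| / 2); last by field; rewrite gt_eqF.
  by lra.
have e_unbounded p u B : 0 < u -> exists k : nat, B < e p (p + u * k%:R).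
  move=> u0; apply: contrapT => /forallNP H.
  have up : 0 < e (p + u) p.
    rewrite lt_neqAle eq_sym dist2_ge0 andbT; apply: e_neq0.
    by rewrite -subr_eq0 addrC addKr gt_eqF.
  have [k k0 kP] := d_large ((B + 1) / e (p + u) p).
  have := e_control _ _ kP (p + u * (Num.truncn k).+1%:R) (p + u) p.
  rewrite mulfVK ?gt_eqF//; have /negP := H (Num.truncn k).+1; rewrite -leNgt => le_B.
  rewrite /e dist2C -/e => /(_ (le_lt_trans le_B _))/wrap[]; first by rewrite ltrDl.
  rewrite ![p + _ - p]addrAC !subrr !add0r normrM (gtr0_norm u0) mulrC ler_pM2r//.
  by rewrite ger0_norm//; apply/negP; rewrite -ltNge; exact: truncnS_gt.
have e_mid_le p u : e p (p - u) <= e p (p + u).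
  apply/ler_addgt0Pr => r r0.
  pose eps := r / (e p (p + u) + 1).
  have e0 := dist2_ge0 x z p (p + u).
  have eps0 : 0 < eps by rewrite divr_gt0// ltr_wpDl.
  have : e p (p - u) <= (1 + eps) * e p (p + u).
    have h : (1 + eps) * d n p (p + u) @[n --> U] --> (1 + eps) * e p (p + u).
      by apply: cvgM => //; exact: cvg_cst.
    apply: (ler_cvg_to (eP p (p - u)) h).
    have h1 := oU _ (d_mid (e p (p + u) + 1) eps0).
    have h2 : \forall n \near U, d n p (p + u) < e p (p + u) + 1.
      by apply: (cvgr_lt _ (eP p (p + u))); rewrite ltrDl.
    by apply: filterS2 h1 h2 => n hn /ltW; exact: hn.
  move/le_trans; apply; rewrite mulrDl mul1r lerD2l /eps mulrAC ler_pdivrMr ?ltr_wpDl//.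
  by rewrite ler_pM2l// lerDl.
have e_mid p u : e p (p + u) = e p (p - u).
  apply/eqP; rewrite eq_le e_mid_le andbT.
  by have := e_mid_le p (- u); rewrite opprK.
have e_homog := dist2_homogeneous x_cont z_cont e_mid e_neq0 e_unbounded.
(* Since [y n] moves with [n], pointwise convergence at [w] is supplemented by equicontinuity, which
   comes from control uniform in [n]. *)
have yw eta : 0 < eta -> \forall n \near U, d n (y n) w <= eta.
  move=> eta0; have [k k0 kP] := d_large ((e (w + 1) w + 1) / eta).
  have h1 : \forall n \near U, d n (w + 1) w < e (w + 1) w + 1.
    by apply: (cvgr_lt _ (eP (w + 1) w)); rewrite ltrDl.
  have h2 : \forall n \near U, `|w - y n| < k^-1.
    by move/cvgrPdist_lt: wP; apply; rewrite invr_gt0.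
  apply: filterS2 h1 h2 => n h1; rewrite distrC -[k^-1]mul1r ltr_pdivlMr// => h2.
  rewrite leNgt; apply/negP => lt_eta.
  have := kP n (w + 1) (y n) w; rewrite [w + 1 - w]addrAC subrr add0r normr1 => /(_ _)/wrap[].
    by rewrite mulrAC ler_pdivlMr//; have := dist2_ge0 (X n) (Y n) (w + 1) w; nra.
  by apply/negP; rewrite -ltNge mulrC.
have Xw : X n (y n) @[n --> U] --> x w.
  apply/cvgrPdist_le => eta eta0.
  have eta2 : 0 < eta / 2 by rewrite divr_gt0.
  have h1 := yw _ (exprn_gt0 2 eta2).
  have h2 : \forall n \near U, `|x w - X n w| <= eta / 2.
    by move/cvgrPdist_le: (xP w); apply.
  apply: filterS2 h1 h2 => n /(sqr_le _ _ _ eta2)[h1 _] h2.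
  rewrite (le_trans (ler_distD (X n w) _ _))// [leRHS](splitr eta) lerD//.
  by rewrite distrC.
have Yw : Y n (y n) @[n --> U] --> z w.
  apply/cvgrPdist_le => eta eta0.
  have eta2 : 0 < eta / 2 by rewrite divr_gt0.
  have h1 := yw _ (exprn_gt0 2 eta2).
  have h2 : \forall n \near U, `|z w - Y n w| <= eta / 2.
    by move/cvgrPdist_le: (zP w); apply.
  apply: filterS2 h1 h2 => n /(sqr_le _ _ _ eta2)[_ h1] h2.
  rewrite (le_trans (ler_distD (Y n w) _ _))// [leRHS](splitr eta) lerD//.
  by rewrite distrC.
have ew : d n (y n) 0 @[n --> U] --> e w 0 by exact: cvg_sqr_dist.
have : e w 0 <= T.
  by apply: (ler_cvg_to ew (cvg_cst T)); exact: nearW.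
rewrite /e dist2C e_homog dist2C -[dist2 x z 1 0]/(e 1 0) e10 mulr1; apply: le_trans.
apply: (ler_cvg_to (cvg_cst c) (_ : y n ^+ 2 @[n --> U] --> w ^+ 2)); last exact: nearW.
by rewrite expr2; under eq_fun do rewrite expr2; exact: cvgM.
Unshelve. all: by end_near. Qed.

End blow_up.

(** * From the equidistant condition to almost equal adjacent chords, and from these to asymptotic
    symmetry *)

Section parametrized_curve.
Context {R : realType} (X Y : R -> R).
Local Notation d2 := (dist2 X Y).
Context (d2_neq0 : forall a b, a != b -> d2 a b != 0).
Context (d2_large : forall t, exists2 k, 0 < k & quasi_control d2 t k).

(** If the chord to [x - u] is too long, an earlier parameter [x - tau * u] lies exactly as far from
    [x] on the curve as [x + u]. The equidistant condition forces [tau] close to 1, and control then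
    puts the images of [x - tau * u] and [x - u] too close together. *)
Lemma equidistant_midpoint : continuous X -> continuous Y ->
  (forall eps, 0 < eps -> exists2 delta, 0 < delta & forall a b x,
    a != x -> b != x -> d2 a x = d2 b x -> d2 a x <= delta ->
    `|a - x| <= (1 + eps) * `|b - x|) ->
  forall eps, 0 < eps -> exists2 delta, 0 < delta & forall x u,
    d2 x (x + u) <= delta -> d2 x (x - u) <= (1 + eps) * d2 x (x + u).
Proof.
move=> X_cont Y_cont equi eps eps0.
(* This is what [weighted] below yields once [d2 x (x + u)] is replaced by its upper bound
   [d2 x (x - u) / (1 + eps)]. *)
pose T := (1 + 2 / eps) * (1 + eps) / (eps / 2).
have [k k0 kP] := d2_large T.
(* With this tolerance [k * (1 - tau) <= 1 / 2], while control demands at least 1. *)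
have k2 : 0 < (2 * k)^-1 by rewrite invr_gt0 mulr_gt0.
have [delta delta0 dP] := equi _ k2.
exists delta => // x u le_delta.
have [->|u0] := eqVneq u 0; first by rewrite subr0 addr0 dist2xx mulr0.
rewrite leNgt; apply/negP => lt_mid.
have rho0 := dist2_ge0 X Y x (x + u).
have [||tau] := @IVT R (fun tau => d2 x (x - tau * u)) 0 1 (d2 x (x + u)) ler01.
- apply: continuous_subspaceT => z.
  have c (Z : R -> R) : continuous Z ->
      {for z, continuous (fun tau : R => Z (x - tau * u))}.
    move=> Zc; apply: (@continuous_comp _ _ _ (fun tau : R => x - tau * u) Z); last exact: Zc.
    by apply: cvgB; [exact: cvg_cst | apply: cvgM; [exact: cvg_id | exact: cvg_cst]].
  by apply: cvg_sqr_dist; try exact: cvg_cst; exact: c.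
- rewrite mul0r subr0 mul1r dist2xx ge_min le_max rho0/=.
  by apply/orP; right; nra.
rewrite in_itv/= => /andP[tau0 tau1] tauE.
have xux : x + u != x by rewrite -subr_eq0 addrAC subrr add0r.
have rho_neq0 : d2 x (x + u) != 0 by apply: d2_neq0; rewrite eq_sym.
have xtx : x - tau * u != x.
  by apply: contraNneq rho_neq0 => e; rewrite -tauE e dist2xx.
have := dP (x + u) (x - tau * u) x xux xtx.
rewrite ![d2 _ x]dist2C tauE => /(_ erefl le_delta).
rewrite [x + u - x]addrAC [x - tau * u - x]addrAC subrr !add0r normrN normrM.
rewrite (ger0_norm tau0) mulrA ler_pMl ?normr_gt0// => tau_ge.
have := kP x (x - tau * u) (x - u).
have -> : x - (x - u) = u by ring.
have -> : x - tau * u - (x - u) = (1 - tau) * u by ring.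
rewrite normrM ger0_norm ?subr_ge0// mulrA => /(_ _)/wrap[]; last first.
  apply/negP; rewrite -ltNge gtr_pMl ?normr_gt0//.
  have : k * ((2 * k)^-1 * tau) <= 2^-1.
    rewrite mulrA invfM mulrCA mulfV ?gt_eqF// mulr1.
    by rewrite -[leRHS]mulr1 ler_pM2l ?invr_gt0.
  have : k * (1 - tau) <= k * ((2 * k)^-1 * tau) by rewrite ler_pM2l//; lra.
  lra.
(* |p - c|^2 <= (1 + l) |m - c|^2 + (1 + 1/l) |p - m|^2 with l = eps / 2 *)
have weighted (p m c : R) : (c - p) ^+ 2 <=
    (1 + eps / 2) * (c - m) ^+ 2 + (1 + 2 / eps) * (m - p) ^+ 2.
  rewrite -subr_ge0.
  rewrite (_ : _ - _ = 2 / eps * (eps / 2 * (c - m) - (m - p)) ^+ 2); last by field; rewrite gt_eqF.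
  by rewrite mulr_ge0 ?sqr_ge0// divr_ge0 ?ltW.
have {}weighted : d2 x (x - u) <= (1 + eps / 2) * d2 x (x - tau * u)
    + (1 + 2 / eps) * d2 (x - tau * u) (x - u).
  have := weighted (X (x - u)) (X (x - tau * u)) (X x).
  have := weighted (Y (x - u)) (Y (x - tau * u)) (Y x).
  by rewrite /dist2; lra.
rewrite tauE in weighted.
rewrite /T mulrAC ler_pdivlMr ?divr_gt0//.
rewrite [leRHS](_ : _ = (1 + eps) * ((1 + 2 / eps) * d2 (x - tau * u) (x - u))); last by ring.
nra.
Qed.

(** Counterexample triples at scales tending to 0 are normalized so that [x] and [b] get parameters
    0 and 1 and unit distance. [blow_up_limit], applied to the parameters [y n] of [a], gives
    [((1 + eps) t)^2 <= t^2]. *)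
Lemma midpoint_asymptotically_symmetric :
  (forall k, 0 < k -> exists2 t, 0 < t & quasi_control d2 t k) ->
  (forall eps, 0 < eps -> exists2 delta, 0 < delta & forall x u,
    d2 x (x + u) <= delta -> d2 x (x - u) <= (1 + eps) * d2 x (x + u)) ->
  forall t eps, 0 < t -> 0 < eps -> exists2 delta, 0 < delta & forall a b x,
    b != x -> d2 b x <= delta -> d2 a x <= t ^+ 2 * d2 b x ->
    `|a - x| <= (1 + eps) * t * `|b - x|.
Proof.
move=> d2_small mid t eps t0 eps0; apply: contrapT => H.
have /choice[f fP] (n : nat) : exists abx : R * R * R, [/\ abx.1.2 != abx.2,
    d2 abx.1.2 abx.2 <= n.+1%:R^-1,
    d2 abx.1.1 abx.2 <= t ^+ 2 * d2 abx.1.2 abx.2 &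
    (1 + eps) * t * `|abx.1.2 - abx.2| < `|abx.1.1 - abx.2| ].
  apply: contrapT => /forallNP Hn; apply: H; exists n.+1%:R^-1; first by rewrite invr_gt0.
  move=> a b x bx le1 le2; rewrite leNgt; apply/negP => lt3.
  by apply: (Hn (a, b, x)).
pose a n := (f n).1.1; pose b n := (f n).1.2; pose x n := (f n).2.
pose s n := b n - x n; pose r n := Num.sqrt (d2 (b n) (x n)).
have s0 n : s n != 0 by rewrite subr_eq0; have [] := fP n.
have d2bx n : 0 < d2 (b n) (x n).
  by rewrite lt_neqAle eq_sym dist2_ge0 andbT; apply: d2_neq0; have [] := fP n.
have r0 n : r n != 0 by rewrite gt_eqF// sqrtr_gt0.
have r2 n : r n ^+ 2 = d2 (b n) (x n) by rewrite sqr_sqrtr// dist2_ge0.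
pose g n p := x n + s n * p.
pose U n p := (X (g n p) - X (x n)) / r n; pose V n p := (Y (g n p) - Y (x n)) / r n.
have dE n p q : dist2 (U n) (V n) p q = d2 (g n p) (g n q) / d2 (b n) (x n).
  by rewrite -r2 /dist2 /U /V; field.
have g0 n : g n 0 = x n by rewrite /g mulr0 addr0.
have g1 n : g n 1 = b n by rewrite /g mulr1 /s subrKC.
have rescaled t' k : quasi_control d2 t' k ->
    forall n, quasi_control (dist2 (U n) (V n)) t' k.
  move=> tk n p q z; rewrite !dE mulrA ler_pM2r ?invr_gt0// => /tk.
  have gB u v : g n u - g n v = s n * (u - v) by rewrite /g; ring.
  by rewrite !gB !normrM mulrCA ler_pM2l ?normr_gt0.
pose y n := (a n - x n) / s n.
have gy n : g n (y n) = a n by rewrite /g /y mulrC divfK// subrKC.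
have [k k0 kP] := d2_large (t ^+ 2).
have : ((1 + eps) * t) ^+ 2 <= t ^+ 2.
  apply: (@blow_up_limit _ U V _ _ _ _ _ _ y k).
  - by move=> n; rewrite /U g0 subrr mul0r.
  - by move=> n; rewrite /V g0 subrr mul0r.
  - by move=> n; rewrite dE g0 g1 divff// gt_eqF.
  - by move=> k' /d2_small[t' t'0 t'k]; exists t' => //; exact: rescaled.
  - by move=> t'; have [k' k'0 t'k] := d2_large t'; exists k' => //; exact: rescaled.
  - move=> e B e0; have [delta delta0 dP] := mid _ e0.
    (* A squared distance [B] after rescaling is at most [B / (n + 1)] before it if [B >= 0];
       [|B| + 1] also covers other [B]. *)
    have B0 : 0 < delta / (`|B| + 1) by rewrite divr_gt0// ltr_wpDl.
    have : \forall n \near \oo, n.+1%:R^-1 < delta / (`|B| + 1).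
      exact: (near_infty_natSinv_lt (PosNum B0)).
    apply: filterS => n; rewrite ltr_pdivlMr ?ltr_wpDl// => nB p u.
    rewrite !dE ler_pdivrMr// mulrA ler_pM2r ?invr_gt0//.
    have -> : g n (p + u) = g n p + s n * u by rewrite /g mulrDr addrA.
    have -> : g n (p - u) = g n p - s n * u by rewrite /g mulrBr addrA.
    move=> le_B; apply: dP; apply: le_trans le_B _.
    have [_ bx _ _] := fP n; rewrite -/(b n) -/(x n) in bx.
    apply: le_trans (ltW nB); rewrite [leRHS]mulrC.
    apply: (@le_trans _ _ ((`|B| + 1) * d2 (b n) (x n))).
      by rewrite ler_pM2r// (le_trans (ler_norm B))// lerDl.
    by rewrite ler_pM2l// ltr_wpDl.
  - move=> n; have [_ _ le_ab _] := fP n; have := kP _ _ _ le_ab.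
    by rewrite -/(a n) -/(b n) -/(x n) normrM normfV ler_pdivrMr// normr_gt0.
  - move=> n; rewrite dE gy g0 ler_pdivrMr//; by have [] := fP n.
  - move=> n; have [_ _ _ lt_ab] := fP n.
    rewrite -[y n ^+ 2]real_normK ?num_real//.
    rewrite ler_pXn2r ?nnegrE ?normr_ge0 ?mulr_ge0 ?addr_ge0 ?ler01 ?(ltW t0) ?(ltW eps0)// ltW//.
    rewrite /y normrM normfV ltr_pdivlMr ?normr_gt0//.
rewrite exprMn ger_pMl ?exprn_gt0// => h.
have := exprn_gt0 2 eps0; move: h; rewrite sqrrD expr1n; lra.
Qed.

End parametrized_curve.

(** * The inverse of h as a parametrization *)

Lemma mdist_real (R : realType) (a b : R) : mdist a b = `|a - b|.
Proof. exact: distrC. Qed.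

Lemma sqr_mdist_Rcomplex (R : realType) (a b : Rcomplex R) :
  mdist a b ^+ 2 =
  (complex.Re a - complex.Re b) ^+ 2 + (complex.Im a - complex.Im b) ^+ 2.
Proof.
rewrite -[mdist a b]/(`|b - a|); case: a b => [a1 a2] [b1 b2].
rewrite -[`|_|]/(Num.sqrt ((b1 - a1) ^+ 2 + (b2 - a2) ^+ 2)) /=.
by rewrite sqr_sqrtr ?addr_ge0 ?sqr_ge0//; ring.
Qed.

Section diameter.
Context {R : realType} {M : metricType R}.
Implicit Types a b x : M.

Lemma mdist_le_diam (S : set M) p q : S p -> S q -> ((mdist p q)%:E <= diam S)%E.
Proof. by move=> Sp Sq; apply: ereal_sup_ubound; exists p => //; exists q. Qed.

Lemma diam3_le a b x (r : R) : mdist a x <= r -> mdist b x <= r ->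
  (diam [set a; b; x] <= (2 * r)%:E)%E.
Proof.
move=> ax bx; have r0 : 0 <= r := le_trans (mdist_ge0 a x) ax.
have near_x p : [set a; b; x] p -> mdist p x <= r.
  by move=> [[->|->]|->]//; rewrite mdistxx.
apply: ge_ereal_sup => _ [p /near_x px [q /near_x qx <-]].
rewrite lee_fin (le_trans (metric_triangle _ x _))// mulr_natl mulr2n lerD//.
by rewrite metric_sym.
Qed.

End diameter.

Lemma near0_right (R : realType) (P : R -> Prop) :
  (\forall r \near 0^'+, P r) -> exists2 r : R, 0 < r & P r.
Proof.
move=> nP; have : \forall r \near 0^'+, 0 < r /\ P r.
  by near=> r; split; near: r => //; exact: nbhs_right_gt.
by move=> /filter_ex[r [r0 Pr]]; exists r.
Unshelve. all: by end_near. Qed.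

(** By surjectivity [eta] takes the value 0, either at a positive point, which serves for every [k],
    or at 0, where continuity provides a positive [s]. *)
Lemma homeomorphism_half_line_small (R : realType) (eta : R -> R) :
  homeomorphism_on [set t : R | 0 <= t] [set t : R | 0 <= t] eta ->
  forall k, 0 < k -> exists2 s, 0 < s & eta s <= k.
Proof.
move=> [[_ _ surj] cont _] k k0.
have [t t0 et] := surj 0 (lexx 0); rewrite /= in t0.
have [t_eq0|t_neq0] := eqVneq t 0; last first.
  by exists t; rewrite ?et ?ltW// lt_neqAle eq_sym t_neq0.
have eta0 : eta 0 = 0 by rewrite -{1}t_eq0.
have eta_cvg : eta x @[x --> within [set t | 0 <= t] (nbhs (0 : R))] --> eta 0.
  exact: (subspace_continuousP _ _).1 cont 0 (lexx 0).
rewrite eta0 in eta_cvg.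
have eta_lt : \forall s \near within [set t | 0 <= t] (nbhs (0 : R)), eta s < k.
  exact: (cvgr_lt _ eta_cvg).
rewrite near_withinE in eta_lt.
have /near0_right[s s0 sP] : \forall s \near 0^'+, 0 <= s -> eta s < k.
  by rewrite near_withinE; apply: filterS eta_lt => s eta_lt _ /eta_lt.
by exists s => //; rewrite ltW// sP//= ltW.
Qed.

Section parametrization.
Context {R : realType} {Gamma : set (Rcomplex R)} {h : Rcomplex R -> R}.
Context {g : R -> Rcomplex R}.
Context (Gamma_g : forall y, Gamma (g y)) (hK : forall x, Gamma x -> g (h x) = x).
Context (gK : forall y, h (g y) = y) (g_cont : continuous g).

Let X y := complex.Re (g y).
Let Y y := complex.Im (g y).
Local Notation d2 := (dist2 X Y).

Let d2E a b : d2 a b = mdist (g a) (g b) ^+ 2.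
Proof. by rewrite sqr_mdist_Rcomplex. Qed.

Let mdist_h x y : mdist (h x) (h y) = `|h x - h y|.
Proof. exact: mdist_real. Qed.

Let g_inj a b : g a = g b -> a = b.
Proof. by move=> e; rewrite -(gK a) e gK. Qed.

Let h_inj x y : Gamma x -> Gamma y -> h x = h y -> x = y.
Proof. by move=> Gx Gy e; rewrite -(hK Gx) e hK. Qed.

Let mdist_gt0P (M : metricType R) (x y : M) : x <> y -> 0 < mdist x y.
Proof. by move=> /eqP; rewrite mdist_gt0. Qed.

Let d2_neq0 a b : a != b -> d2 a b != 0.
Proof.
move=> ab; rewrite d2E expf_neq0// gt_eqF//; apply: mdist_gt0P => /g_inj.
exact/eqP.
Qed.

Let coordinate_cont (c : Rcomplex R -> R) :
  (forall z w, (c z - c w) ^+ 2 <= mdist z w ^+ 2) -> continuous (c \o g).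
Proof.
move=> c_le p; apply/cvgrPdist_le => eta eta0.
have /metricType_numDomainType.cvgrPdist_lt/(_ _ eta0) := @g_cont p.
apply: filterS => q /ltW pq /=.
rewrite -(@ler_pXn2r _ 2)// ?nnegrE ?(ltW eta0)// real_normK ?num_real//.
by rewrite (le_trans (c_le _ _))// ler_pXn2r ?nnegrE ?mdist_ge0// ltW.
Qed.

Let X_cont : continuous X.
Proof.
apply: (@coordinate_cont (@complex.Re R)) => z w.
by rewrite sqr_mdist_Rcomplex lerDl sqr_ge0.
Qed.

Let Y_cont : continuous Y.
Proof.
apply: (@coordinate_cont (@complex.Im R)) => z w.
by rewrite sqr_mdist_Rcomplex lerDr sqr_ge0.
Qed.

Let ratio_le a b x (t : R) : b <> x -> 0 <= t -> d2 a x <= t ^+ 2 * d2 b x ->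
  mdist (g a) (g x) / mdist (g b) (g x) <= t.
Proof.
move=> bx t0; rewrite !d2E -exprMn ler_pXn2r ?nnegrE ?mulr_ge0 ?mdist_ge0//.
by rewrite ler_pdivrMr// mdist_gt0P// => /g_inj.
Qed.

Section quasisymmetric.
Context (h_qs : quasisymmetric_on Gamma h).

Let distinct_control : exists eta : R -> R,
  homeomorphism_on [set t : R | 0 <= t] [set t : R | 0 <= t] eta /\
  forall a b x s, a <> b -> a <> x -> b <> x -> 0 <= s ->
    d2 a x <= s ^+ 2 * d2 b x -> `|a - x| <= eta s * `|b - x|.
Proof.
have [_ [eta [eta_homeo qs]]] := h_qs; exists eta; split=> // a b x s ab ax bx s0.
move=> /(ratio_le bx s0); move=> /qs; rewrite !mdist_h !gK => /(_ _)/wrap[//|].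
by move=> H; rewrite -ler_pdivrMr ?normr_gt0 ?subr_eq0; [apply: H => // /g_inj|exact/eqP].
Qed.

Let d2_large t : exists2 k, 0 < k & quasi_control d2 t k.
Proof.
(* The square root undoes the squares in [d2], the inner absolute value allows negative [t], and the
   added 1 settles the case [a = b]. *)
have [eta [_ H]] := distinct_control; exists (`|eta (Num.sqrt `|t|)| + 1).
  by rewrite ltr_wpDl.
move=> a b x le_t.
have [->|/eqP ax] := eqVneq a x; first by rewrite subrr normr0 mulr_ge0// addr_ge0.
have [bx|/eqP bx] := eqVneq b x.
  move: le_t; rewrite bx dist2xx mulr0 => le0.
  by have := d2_neq0 (introN eqP ax); rewrite eq_le le0 dist2_ge0.
have [->|/eqP ab] := eqVneq a b; first by rewrite ler_peMl// lerDr.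
apply: le_trans (H a b x (Num.sqrt `|t|) ab ax bx (sqrtr_ge0 _) _) _.
  rewrite sqr_sqrtr// (le_trans le_t)// ler_wpM2r ?dist2_ge0//; exact: ler_norm.
by rewrite ler_wpM2r// (le_trans (ler_norm _))// lerDl.
Qed.

Let d2_small k : 0 < k -> exists2 t, 0 < t & quasi_control d2 t k.
Proof.
move=> k0; have [eta [eta_homeo H]] := distinct_control.
have [s s0 eta_s] := homeomorphism_half_line_small eta_homeo k0.
(* The cap [2^-1 < 1] excludes [a = b] unless both equal [x]. *)
have t0 : 0 < Num.min (s ^+ 2) 2^-1 by rewrite lt_min exprn_gt0//= invr_gt0.
exists (Num.min (s ^+ 2) 2^-1) => // a b x le_t.
have [->|/eqP ax] := eqVneq a x; first by rewrite subrr normr0 mulr_ge0// ltW.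
have ax0 : 0 < d2 a x by rewrite lt_neqAle eq_sym dist2_ge0 d2_neq0//; exact/eqP.
have [bx|/eqP bx] := eqVneq b x.
  by move: le_t; rewrite bx dist2xx mulr0 leNgt ax0.
have [ab|/eqP ab] := eqVneq a b.
  have : Num.min (s ^+ 2) 2^-1 <= 2^-1 by rewrite ge_min lexx orbT.
  by move: le_t ax0; rewrite ab; nra.
apply: le_trans (H a b x s ab ax bx (ltW s0) _) _.
  by rewrite (le_trans le_t)// ler_wpM2r ?dist2_ge0// ge_min lexx.
by rewrite ler_wpM2r.
Qed.

Lemma EWAS_AS : EWAS Gamma h -> AS Gamma h.
Proof.
move=> ewas t t0 eps eps0.
have equi e : 0 < e -> exists2 delta, 0 < delta & forall a b x,
    a != x -> b != x -> d2 a x = d2 b x -> d2 a x <= delta ->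
    `|a - x| <= (1 + e) * `|b - x|.
  move=> e0.
  have /near0_right[r r0 Hr] : \forall r \near 0^'+, (Heq Gamma h r < (1 + e)%:E)%E.
    have [fin /(cvgr_lt _)] := (fine_cvgP _ _).1 ewas.
    move=> /(_ (1 + e)); rewrite ltrDl => /(_ e0); apply: filterS2 fin => r fin /=.
    by rewrite -lte_fin fineK.
  have r20 : 0 < r / 2 by rewrite divr_gt0.
  (* Two points within [r / 2] of [x] form with it a triple of diameter at most [r]; the square
     matches [d2]. *)
  exists ((r / 2) ^+ 2); first by rewrite exprn_gt0.
  move=> a b x /eqP ax /eqP bx; rewrite !d2E => eq_d.
  rewrite ler_pXn2r ?nnegrE ?mdist_ge0 ?(ltW r20)// => le_d.
  have {}eq_d : mdist (g a) (g x) = mdist (g b) (g x).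
    by apply/eqP; rewrite -(@eqrXn2 _ 2) ?mdist_ge0//; apply/eqP.
  rewrite -ler_pdivrMr ?normr_gt0 ?subr_eq0; last exact/eqP.
  have -> : `|a - x| / `|b - x| = mdist (h (g a)) (h (g x)) / mdist (h (g b)) (h (g x)).
    by rewrite !mdist_h !gK.
  rewrite -lee_fin (le_trans _ (ltW Hr))//.
  set p := _ / _; set q := mdist (h (g b)) (h (g x)) / mdist (h (g a)) (h (g x)).
  apply: (@le_trans _ _ (Num.max p q)%:E); first by rewrite lee_fin le_max lexx.
  apply: ereal_sup_ubound; exists (g a), (g b), (g x); split=> //; split=> //.
  apply/andP; split.
    apply: lt_le_trans (mdist_le_diam (p := g a) (q := g x) _ _).
    - by rewrite lte_fin mdist_gt0P// => /g_inj.
    - by left; left.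
    - by right.
  have -> : r = 2 * (r / 2) by field.
  by apply: diam3_le => //; rewrite -eq_d.
have mid := equidistant_midpoint d2_neq0 d2_large X_cont Y_cont equi.
have [delta delta0 H] :=
  midpoint_asymptotically_symmetric d2_neq0 d2_large d2_small mid t0 eps0.
exists (Num.sqrt delta); first by rewrite sqrtr_gt0.
move=> a b x Ga Gb Gx ab ax bx le_diam le_t.
have bx0 : 0 < mdist b x by exact: mdist_gt0P.
have hbx : h b <> h x by move=> /(h_inj Gb Gx).
rewrite ler_pdivrMr ?mdist_gt0P// !mdist_h.
apply: H; rewrite ?d2E ?hK//; first exact/eqP.
  rewrite -[leRHS]sqr_sqrtr ?(ltW delta0)// ler_pXn2r ?nnegrE ?mdist_ge0 ?sqrtr_ge0//.
  rewrite -lee_fin (le_trans _ le_diam)//; apply: mdist_le_diam; last by right.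
  by left; right.
rewrite -exprMn ler_pXn2r ?nnegrE ?mulr_ge0 ?mdist_ge0 ?(ltW t0)//.
by rewrite -ler_pdivrMr.
Qed.

End quasisymmetric.

(** [Heq] admits triples with [a = b], whose ratio is 1, and continuity of [g] supplies such triples
    of arbitrarily small positive diameter. *)
Lemma Heq_ge1 r : 0 < r -> (1 <= Heq Gamma h r)%E.
Proof.
move=> r0.
have r20 : 0 < r / 2 by rewrite divr_gt0.
have : \forall q \near 0^'+, mdist (g 0) (g q) < r / 2.
  have /metricType_numDomainType.cvgrPdist_lt/(_ _ r20) := @g_cont 0.
  by rewrite near_withinE; apply: filterS => q + _.
move=> /near0_right[q q0 gq].
have gqn : g q <> g 0 by move=> /g_inj q_eq0; move: q0; rewrite q_eq0 ltxx.
apply: ereal_sup_ubound; exists (g q), (g q), (g 0); split=> //; split=> //.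
  apply/andP; split.
    apply: lt_le_trans (mdist_le_diam (p := g q) (q := g 0) _ _).
    - by rewrite lte_fin mdist_gt0P.
    - by left; left.
    - by right.
  have -> : r = 2 * (r / 2) by field.
  by apply: diam3_le => //; rewrite metric_sym ltW.
rewrite divff ?maxxx// gt_eqF// mdist_gt0P// !gK => q_eq0.
by move: q0; rewrite q_eq0 ltxx.
Qed.

Lemma WAS_Heq_le eps : 0 < eps -> WAS Gamma h ->
  exists2 delta, 0 < delta & forall r, r <= delta -> (Heq Gamma h r <= (1 + eps)%:E)%E.
Proof.
move=> eps0 /(_ _ eps0)[delta delta0 H]; exists delta => // r le_r.
apply: ge_ereal_sup => _ [a [b [x [[Ga Gb Gx] [eq_d /andP[diam0 le_diam] ->]]]]].
have [ab|/eqP ab] := eqVneq a b.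
  rewrite -ab maxxx divff ?lee_fin ?lerDl ?(ltW eps0)// gt_eqF// mdist_gt0P//.
  move=> /(h_inj Ga Gx) ax; move: diam0; rewrite -ab -ax.
  rewrite ltNge => /negP; apply.
  by apply: (le_trans (diam3_le (r := 0) _ _)); rewrite ?mdistxx ?mulr0.
have ax : a <> x.
  move=> ax; apply: ab; rewrite ax; apply/esym/mdist_positivity.
  by rewrite -eq_d ax mdistxx.
have bx : b <> x.
  move=> bx; apply: ab; rewrite bx; apply/mdist_positivity.
  by rewrite eq_d bx mdistxx.
rewrite lee_fin ge_max -[1 + eps]mulr1.
have le_delta : (diam [set a; b; x] <= delta%:E)%E.
  by rewrite (le_trans le_diam)// lee_fin.
(* The two entries of the maximum come from WAS for [(a, b, x)] and [(b, a, x)], each with ratio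
   1. *)
apply/andP; split; apply: H => //; try exact: nesym.
- by rewrite eq_d divff// gt_eqF// mdist_gt0P.
- by rewrite (_ : [set b; a; x] = [set a; b; x])// [[set b; a]]setUC.
- by rewrite eq_d divff// gt_eqF// mdist_gt0P.
Qed.

Lemma WAS_EWAS : WAS Gamma h -> EWAS Gamma h.
Proof.
move=> was; apply/fine_cvgP.
have near_le eps : 0 < eps ->
    \forall r \near 0^'+, (1 <= Heq Gamma h r <= (1 + eps)%:E)%E.
  move=> eps0; have [delta delta0 H] := WAS_Heq_le eps0 was.
  near=> r; rewrite H ?andbT; last by near: r; exact: nbhs_right_le.
  by apply: Heq_ge1; near: r; exact: nbhs_right_gt.
split.
  apply: filterS (near_le _ ltr01) => r /andP[ge1 le2].
  by rewrite ge0_fin_numE ?(le_lt_trans le2) ?ltry// (le_trans _ ge1).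
apply/cvgrPdist_le => eps eps0; apply: filterS (near_le _ eps0) => r /=.
case: (Heq Gamma h r) => [s| |] //=; rewrite ?lee_fin//; last first.
  by move=> /andP[_]; rewrite leye_eq.
by move=> /andP[ge1 le_s]; rewrite distrC ger0_norm ?subr_ge0// lerBlDl.
Unshelve. all: by end_near. Qed.

End parametrization.

Theorem theorem1p2 (R : realType) (Gamma : set (Rcomplex R))
    (h : Rcomplex R -> R)
    (Gamma_quasiline : quasiline Gamma)
    (h_homeo : homeomorphism_on Gamma [set: R] h)
    (h_qs : quasisymmetric_on Gamma h) :
  (EWAS Gamma h -> AS Gamma h) /\
  ((EWAS Gamma h <-> WAS Gamma h) /\ (WAS Gamma h <-> AS Gamma h)).
Proof.
have [[_ _ h_surj] _ [g [hK g_within]]] := h_homeo.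
have g_cont : continuous g := (continuous_subspace_setT g).2 g_within.
have Gamma_g y : Gamma (g y).
  by have [x Gx <-] := h_surj y I; rewrite hK.
have gK y : h (g y) = y.
  by have [x Gx <-] := h_surj y I; rewrite hK.
have ewas_as : EWAS Gamma h -> AS Gamma h := EWAS_AS Gamma_g hK gK g_cont h_qs.
have was_ewas : WAS Gamma h -> EWAS Gamma h := WAS_EWAS Gamma_g hK gK g_cont.
have as_was : AS Gamma h -> WAS Gamma h by move=> /(_ 1 ltr01).
by do !split; auto.
Qed.
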